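(* Let $\lambda$ be the bicombing on $\mathbb{R}^2$ given by linear segments, $\lambda(p,q,t)=(1-t)p+tq$. With $X$, $f$, $\pi$ as defined in the context and $p_x,q_x$ denoting the first coordinates of $p,q$, the map $\sigma\colon X\times X\times[0,1]\to X$ defined by $$\sigma(p,q,t):=\begin{cases}(\pi\circ\lambda)(p,q,t),&\text{if }p_x\le q_x,\\ (f\circ\pi\circ\lambda)(f^{-1}(p),f^{-1}(q),t),&\text{if }q_x\le p_x,\end{cases}$$ is a non-reversible conical bicombing on $X$ equipped with $\|\cdot\|_\infty$.
   Context: General definitions. Let $(X,d)$ be a metric space. A (geodesic) bicombing on $X$ is a map $\sigma\colon X\times X\times[0,1]\to X$ such that, writing $\sigma_{pq}(t):=\sigma(p,q,t)$, for all $p,q\in X$ one has $\sigma_{pq}(0)=p$, $\sigma_{pq}(1)=q$, and $d(\sigma_{pq}(t),\sigma_{pq}(s))=|t-s|\cdot d(p,q)$ for all $s,t\in[0,1]$. It is conical if $d(\sigma_{pq}(t),\sigma_{p'q'}(t))\le(1-t)\,d(p,p')+t\,d(q,q')$ for all $p,q,p',q'\in X$ and $t\in[0,1]$; reversible if $\sigma_{pq}(t)=\sigma_{qp}(1-t)$ for all $p,q\in X$, $t\in[0,1]$ (non-reversible otherwise). The space and maps. Equip $\mathbb{R}^2$ with the maximum norm $\|\cdot\|_\infty$. Let $s(x,y):=(x,-y)$ and $$X:=\{(x,y)\in\mathbb{R}^2:x\in[-2,1],\ |x|-1\le y\le||x|-1|\},\qquad A:=\{(x,y)\in\mathbb{R}^2:|x+1|\le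 y\le1\},$$ $X':=s(X)$, $A':=s(A)$, $Y:=X\cup A$, $Y':=X'\cup A'$. Let $f\colon X'\to X$ be the bijective isometry $f(x,y)=(x,y)$ if $x\in[-1,1]$ and $f(x,y)=s(x,y)$ if $x\in[-2,-1]$. Let $\pi\colon Y\cup Y'\to X\cup X'$ be given by $\pi(x,y):=(x,\operatorname{sgn}(y)\min\{|y|,||x|-1|\})$; it maps $Y$ to $X$ and $Y'$ to $X'$. *)

(* Defs.v *)
From HB Require Import structures.
From mathcomp Require Import all_boot all_order all_algebra.
From mathcomp Require Import lra.
From mathcomp Require Import all_classical all_reals all_analysis.

Set Implicit Arguments.
Unset Strict Implicit.
Unset Printing Implicit Defensive.

Import Order.TTheory GRing.Theory Num.Theory.
Import numFieldNormedType.Exports.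

Local Open Scope classical_set_scope.
Local Open Scope ring_scope.

(* A subset [X] of a metric space carries the induced metric.  A map
   X * X * [0,1] -> X is represented by a function on the ambient types whose
   values matter only for end points in [X] and parameters in [0,1]; that it
   takes values in [X] is the first clause of [bicombing]. *)
Section Bicombings.
Context {R : realType} {M : metricType R} (X : set M).
Implicit Types (sigma : M -> M -> R -> M) (p q : M) (s t : R).

Definition bicombing sigma : Prop :=
  (forall p q t, X p -> X q -> 0 <= t <= 1 -> X (sigma p q t)) /\
  (forall p q, X p -> X q ->
    [/\ sigma p q 0 = p,
        sigma p q 1 = q
      & forall s t, 0 <= s <= 1 -> 0 <= t <= 1 ->
          mdist (sigma p q t) (sigma p q s) = `|t - s| * mdist p q]).

Definition conical sigma : Prop :=
  forall p q p' q' t, X p -> X q -> X p' -> X q' -> 0 <= t <= 1 ->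
    mdist (sigma p q t) (sigma p' q' t)
      <= (1 - t) * mdist p p' + t * mdist q q'.

Definition reversible sigma : Prop :=
  forall p q t, X p -> X q -> 0 <= t <= 1 -> sigma p q t = sigma q p (1 - t).

End Bicombings.

(* The library norm on the product R * R is the maximum norm ([prod_normE]). *)
Section MaxMetric.
Variable R : realType.

Definition max_dist (p q : R * R) : R := `|p - q|.

Fact max_dist_ge0 (p q : R * R) : 0 <= max_dist p q.
Proof. exact: normr_ge0. Qed.

Fact max_dist_positivity (p q : R * R) : max_dist p q = 0 -> p = q.
Proof. by move=> /normr0_eq0/subr0_eq. Qed.

Fact ball_max_dist (p : R * R) (e : R) : ball p e = [set q | max_dist p q < e].
Proof. by rewrite -ball_normE. Qed.

HB.instance Definition _ := PseudoMetric_isMetric.Build R (R * R)%type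
  max_dist_ge0 max_dist_positivity ball_max_dist.

End MaxMetric.

Section Example.
Variable R : realType.
Implicit Types (p q : R * R) (t : R).

Definition reflect_y p : R * R := (p.1, - p.2).

Definition spaceX : set (R * R) :=
  [set p | -2 <= p.1 <= 1 /\ `|p.1| - 1 <= p.2 <= `| `|p.1| - 1 | ].

Definition spaceX' : set (R * R) := reflect_y @` spaceX.

(* The formulas for [isoX] and [projX] are meant only on [spaceX'] and on
   [spaceX] and [spaceX'] enlarged by the triangles |x + 1| <= |y| <= 1. *)
Definition isoX p : R * R := if -1 <= p.1 then p else reflect_y p.

(* A genuine inverse, since [isoX] maps [spaceX'] bijectively onto [spaceX]
   ([isoX_bij]). *)
Definition isoX_inv : R * R -> R * R := pinv spaceX' isoX.

Definition projX p : R * R :=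
  (p.1, Num.sg p.2 * Num.min `|p.2| `| `|p.1| - 1 |).

Definition segment p q t : R * R := (1 - t) *: p + t *: q.

Definition sigma p q t : R * R :=
  if p.1 <= q.1 then projX (segment p q t)
  else isoX (projX (segment (isoX_inv p) (isoX_inv q) t)).

Fact isoXK : involutive isoX.
Proof.
move=> [x y]; rewrite /isoX /reflect_y /=.
by case: (lerP (-1) x) => x1 /=; [rewrite x1|rewrite leNgt x1 opprK].
Qed.

Fact spaceX_norm p : spaceX p -> `|p.2| <= `| `|p.1| - 1 |.
Proof.
case: p => x y [_ /= /andP[h1 h2]]; rewrite ler_norml h2 andbT.
by apply: le_trans h1; exact: lerNnormlW.
Qed.

Fact spaceX_id p : -1 <= p.1 -> spaceX (reflect_y p) -> spaceX p.
Proof.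
case: p => x y /= x1 [/= /andP[x2 x3] /andP[h1 h2]]; split=> /=.
  by rewrite x2.
have x4 : `|x| <= 1 by rewrite ler_norml x1.
move: h1 h2; rewrite (ler0_norm (x := _ - 1)) ?subr_le0// => h1 h2.
by apply/andP; split; lra.
Qed.

Lemma isoX_bij : set_bij spaceX' spaceX isoX.
Proof.
have rK p : reflect_y (reflect_y p) = p.
  by case: p => x y; rewrite /reflect_y /= opprK.
split.
- move=> _ [p Xp <-]; rewrite /isoX; case: ifPn => p1; last by rewrite rK.
  by apply: spaceX_id => //; rewrite rK.
- by move=> p q _ _ /(congr1 isoX); rewrite !isoXK.
- move=> p Xp; exists (isoX p); last exact: isoXK.
  exists (reflect_y (isoX p)); last exact: rK.
  rewrite /isoX; case: ifPn => p1; last by rewrite rK.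
  by apply: spaceX_id; rewrite ?rK.
Qed.

Fact isoX_invE p : spaceX p -> isoX_inv p = isoX p.
Proof.
move=> Xp; apply: (can_inj isoXK); rewrite isoXK.
have [_ _ surj] := isoX_bij.
by apply: (surjpK _ surj); rewrite inE.
Qed.

Fact projX_id p : `|p.2| <= `| `|p.1| - 1 | -> projX p = p.
Proof.
by case: p => x y h; rewrite /projX min_l//= -numEsg.
Qed.

(* The two formulas defining [sigma] agree where both apply. *)
Lemma sigma_ge p q t : spaceX p -> spaceX q -> q.1 <= p.1 ->
  sigma p q t = isoX (projX (segment (isoX_inv p) (isoX_inv q) t)).
Proof.
move=> Xp Xq qp; rewrite /sigma; case: ifPn => // pq.
have e : p.1 = q.1 by apply/eqP; rewrite eq_le pq qp.
rewrite !isoX_invE//; case: (lerP (-1) p.1) => p1.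
  rewrite [isoX p]/isoX [isoX q]/isoX -e p1 /isoX ifT//.
  by rewrite /projX /segment /= -e -mulrDl subrK mul1r.
have {e} <- : p = q.
  move: Xp Xq e p1 {qp pq}; case: p => x y; case: q => x' z.
  move=> [_ /= h] [_ /= h'] /= e x1.
  rewrite -{}e in h' *.
  have x2 : `|x| = - x by rewrite ltr0_norm// (lt_trans x1)// ltrN10.
  move: h h'; rewrite x2 (ger0_norm (x := _ - 1)); last lra.
  by move=> h h'; congr (_, _); lra.
have segpp r : segment r r t = r by rewrite /segment -scalerDl subrK scale1r.
have np := spaceX_norm Xp.
rewrite !segpp !projX_id ?isoXK//.
by rewrite /isoX (leNgt (-1)) p1 /= normrN.
Qed.

End Example.

(* Main.v *)
Require Import Defs.
From mathcomp Require Import all_boot all_order all_algebra.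
From mathcomp Require Import ring lra.
From mathcomp Require Import all_classical all_reals all_analysis.

(** Inside the trapezoid Y = X ∪ A, which is convex, the retraction projX is
    the vertical truncation (x, y) |-> (x, min y |x + 1|) onto X, so it is
    1-Lipschitz for the maximum norm.  Truncated segments, [upper p q], hence
    form a conical bicombing on X.

    The isometry f : X' -> X turns into a symmetry of X once X' is identified
    with X by reflection: [flip] reflects the square |x| + |y| <= 1 in the
    x-axis and fixes the tail x <= -1 ([flip_dist]).  In these terms sigma p q
    is [upper p q] when the segment runs to the right and the conjugate of
    [upper] by [flip], called [lower], when it runs to the left
    ([sigma_rightward], [sigma_leftward]).  Both are conical bicombings, so what
    remains is the conical inequality between a rightward segment p q and a
    leftward segment p' q' ([upper_lower_conical]).

    - If p or q' lies in the square, so does the whole of its segment.  The two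
      constructions agree there ([lower_square]), and one of them serves both
      pairs.
    - If p and q' lie in the tail, distances from them to points of X are
      differences of abscissae ([dist_tail]), and abscissae move affinely.  That
      settles the case where one of the points compared is in the tail; when
      both are in the square, going from one to the other through the cusp
      (-1, 0) is short enough, because p and q' lie on the other side of the
      cusp ([dist_cusp]).

    Reversibility fails between (-2, 1) and (1, 0): the two midpoints are
    (-1/2, 1/2) and (-1/2, -1/2). *)

Set Implicit Arguments.
Unset Strict Implicit.
Unset Printing Implicit Defensive.

Import Order.TTheory GRing.Theory Num.Theory.
Import numFieldNormedType.Exports.

Local Open Scope classical_set_scope.
Local Open Scope ring_scope.

(** * Bicombings in a metric space *)

Section GeneralBicombings.
Context {R : realType} {M : metricType R}.
Implicit Types (X : set M) (c : M -> M -> R -> M) (g : M -> M) (p q : M).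

(** A path from p to q with Lipschitz constant d(p, q) has constant speed: a
    subarc that is too short could not be compensated by the other two. *)
Lemma lipschitz_geodesic (c : R -> M) p q :
  c 0 = p -> c 1 = q ->
  (forall s t, 0 <= s <= 1 -> 0 <= t <= 1 ->
    mdist (c t) (c s) <= `|t - s| * mdist p q) ->
  forall s t, 0 <= s <= 1 -> 0 <= t <= 1 ->
    mdist (c t) (c s) = `|t - s| * mdist p q.
Proof.
move=> c0 c1 lip s t s01 t01.
wlog st : s t s01 t01 / s <= t.
  move=> wl; case: (leP s t) => [|/ltW] st; first exact: wl.
  by rewrite metric_sym distrC; exact: wl.
apply: le_anti; rewrite lip//=.
have i0 : 0 <= (0 : R) <= 1 by rewrite lexx ler01.
have i1 : 0 <= (1 : R) <= 1 by rewrite lexx ler01.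
have ds := lip 0 s i0 s01; have d1 := lip t 1 t01 i1.
move: ds d1; rewrite c0 c1 subr0 metric_sym (metric_sym q).
have [s0 s1] := andP s01; have [t0 t1] := andP t01.
rewrite !ger0_norm ?subr_ge0// => ds d1.
have tri := metric_triangle p (c s) q.
have tri2 := metric_triangle (c s) (c t) q.
rewrite (metric_sym (c t)); lra.
Qed.

Definition conjugate g c p q t := g (c (g p) (g q) t).

Lemma bicombing_conjugate X g c :
  involutive g -> (forall p, X p -> X (g p)) ->
  (forall p q, X p -> X q -> mdist (g p) (g q) = mdist p q) ->
  bicombing X c -> bicombing X (conjugate g c).
Proof.
move=> gK Xg gd [Xc cb]; split=> [p q t Xp Xq t01|p q Xp Xq].
  by apply/Xg/Xc => //; exact: Xg.
have [c0 c1 cd] := cb _ _ (Xg _ Xp) (Xg _ Xq).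
rewrite /conjugate c0 c1 !gK; split=> // s t s01 t01.
by rewrite gd ?cd ?gd//; apply: Xc => //; exact: Xg.
Qed.

Lemma conical_conjugate X g c :
  (forall p, X p -> X (g p)) ->
  (forall p q, X p -> X q -> mdist (g p) (g q) = mdist p q) ->
  bicombing X c -> conical X c -> conical X (conjugate g c).
Proof.
move=> Xg gd [Xc _] cc p q p' q' t Xp Xq Xp' Xq' t01.
have XX a b : X a -> X b -> X (c (g a) (g b) t).
  by move=> Xa Xb; apply: Xc => //; exact: Xg.
rewrite /conjugate (gd _ _ (XX _ _ Xp Xq) (XX _ _ Xp' Xq')).
by rewrite -(gd _ _ Xp Xp') -(gd _ _ Xq Xq'); apply: cc => //; exact: Xg.
Qed.

End GeneralBicombings.

(** * The plane with the maximum norm *)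

Section MaxNorm.
Variable R : realType.
Implicit Types (p q : R * R) (s t : R).

Lemma distE p q : mdist p q = Num.max `|p.1 - q.1| `|p.2 - q.2|.
Proof. by []. Qed.

Lemma dist_le p q (c : R) : (mdist p q <= c) =
  [&& - c <= p.1 - q.1, p.1 - q.1 <= c, - c <= p.2 - q.2 & p.2 - q.2 <= c].
Proof. by rewrite distE ge_max !ler_norml !andbA. Qed.

Lemma segment_dist p q p' q' t : 0 <= t <= 1 ->
  mdist (segment p q t) (segment p' q' t)
    <= (1 - t) * mdist p p' + t * mdist q q'.
Proof.
move=> /andP[t0 t1]; change (`|segment p q t - segment p' q' t| <=
  (1 - t) * `|p - p'| + t * `|q - q'|).
have -> : segment p q t - segment p' q' t = (1 - t) *: (p - p') + t *: (q - q').
  by rewrite /segment !scalerBr opprD addrACA.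
apply: le_trans (ler_normD _ _) _.
by rewrite !normrZ (ger0_norm t0) ger0_norm// subr_ge0.
Qed.

Lemma segment_speed p q s t :
  mdist (segment p q t) (segment p q s) = `|t - s| * mdist p q.
Proof.
change (`|segment p q t - segment p q s| = `|t - s| * `|p - q|).
have -> : segment p q t - segment p q s = (t - s) *: (q - p).
  by apply: injective_projections; rewrite /= /GRing.scale /=; ring.
by rewrite normrZ distrC (distrC q).
Qed.

Lemma segment0 p q : segment p q 0 = p.
Proof. by rewrite /segment subr0 scale1r scale0r addr0. Qed.

Lemma segment1 p q : segment p q 1 = q.
Proof. by rewrite /segment subrr scale1r scale0r add0r. Qed.

(** * The space X inside the trapezoid *)

(** The set Y = X ∪ A, in a form that shows its convexity. *)
Definition trapezoid : set (R * R) :=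
  [set p | [/\ -1 <= p.1 + p.2, p.2 <= 1, p.1 + p.2 <= 1 & p.1 - p.2 <= 1]].

Lemma trapezoid_segment p q t : trapezoid p -> trapezoid q -> 0 <= t <= 1 ->
  trapezoid (segment p q t).
Proof.
case: p q => [x y] [x' y'] [/= a1 a2 a3 a4] [/= b1 b2 b3 b4] /andP[t0 t1].
by rewrite /trapezoid /segment /= /GRing.scale /=; split; nra.
Qed.

Lemma spaceXE p : spaceX p <-> trapezoid p /\ p.2 <= `|p.1 + 1|.
Proof.
case: p => x y; rewrite /spaceX /trapezoid /=.
split=> [[/andP[x1 x2] /andP[]]|[[a1 a2 a3 a4]]].
- case: (ger0P x) => x0; case: (ger0P (_ - 1)) => x3; case: (ger0P (x + 1));
    move=> *; (split; [split|]); lra.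
- case: (ger0P x) => x0; case: (ger0P (_ - 1)) => x3; case: (ger0P (x + 1));
    move=> *; split; apply/andP; split; lra.
Qed.

(** For x <= 0 the bound ||x| - 1| in projX is |x + 1|.  For x > 0 the two
    differ, but y <= 1 - x already makes both of them harmless. *)
Lemma projXE p : trapezoid p -> projX p = (p.1, Num.min p.2 `|p.1 + 1|).
Proof.
case: p => x y [/= a1 a2 a3 a4]; rewrite /projX /=; congr (_, _).
have [y0|y0|->] := ltrgt0P y; last 2 first.
- (* below the axis the trapezoid lies in the square, where nothing is cut *)
  rewrite ltr0_sg// !min_l; first by rewrite mulN1r opprK.
    by case: (ger0P (x + 1)) => ?; lra.
  by case: (ger0P x) => x0; case: (ger0P (_ - 1)) => ?; lra.
- by rewrite sgr0 mul0r min_l.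
rewrite gtr0_sg// mul1r.
case: (ger0P x) => x0; case: (ger0P (x - 1)) => x1; case: (ger0P (- x - 1));
  case: (ger0P (x + 1)) => ? ?; rewrite /Num.min; do 2 case: ltP => ?; lra.
Qed.

Lemma projX_trapezoid p : trapezoid p -> spaceX (projX p).
Proof.
move=> Yp; rewrite projXE//; case: p Yp => x y [/= a1 a2 a3 a4].
apply/spaceXE; rewrite /trapezoid /=.
by case: (ger0P (x + 1)) => ?; rewrite /Num.min; case: ltP => ?;
  (split; [split|]); lra.
Qed.

Lemma projX_lipschitz p q : trapezoid p -> trapezoid q ->
  mdist (projX p) (projX q) <= mdist p q.
Proof.
move=> Yp Yq; rewrite !projXE// dist_le /=.
have := lexx (mdist p q); rewrite {1}dist_le => /and4P[d1 d2 d3 d4].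
rewrite d1 d2 /=; set d := mdist p q in d1 d2 d3 d4 *.
case: (ger0P (p.1 + 1)) => ?; case: (ger0P (q.1 + 1)) => ?;
  rewrite /Num.min; do 2 case: ltP => ?; apply/andP; split; lra.
Qed.

Lemma projX_spaceX p : spaceX p -> projX p = p.
Proof. by move=> Xp; apply: projX_id; exact: spaceX_norm. Qed.

Lemma tail_snd p : spaceX p -> p.1 <= -1 -> p.2 = - p.1 - 1.
Proof.
by case: p => x y /spaceXE[[/= a1 a2 a3 a4]]; case: (ger0P (x + 1)) => *; lra.
Qed.

Lemma square_snd p : spaceX p -> -1 <= p.1 -> `|p.2| <= 1 - `|p.1|.
Proof.
case: p => x y /spaceXE[[/= a1 a2 a3 a4]].
by case: (ger0P (x + 1)) => *; rewrite ler_norml;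
  case: (ger0P x) => *; apply/andP; split; lra.
Qed.

Lemma square_spaceX p : `|p.2| <= 1 - `|p.1| -> spaceX p.
Proof.
case: p => x y /=; rewrite ler_norml => /andP[a1 a2]; apply/spaceXE.
move: a1 a2; rewrite /trapezoid /=.
by case: (ger0P x) => ? ? ?; case: (ger0P (x + 1)) => ?; (split; [split|]); lra.
Qed.

(** X lies in the cone |y| <= |x + 1| with apex the cusp (-1, 0), and the tail
    runs along the boundary of that cone; hence every segment from the tail to
    X has slope between -1 and 1. *)
Lemma dist_tail p q : spaceX p -> spaceX q -> p.1 <= -1 ->
  mdist p q = `|p.1 - q.1|.
Proof.
move=> Xp Xq p1; rewrite distE; apply: max_l; rewrite (tail_snd Xp p1).
case: (lerP q.1 (-1)) => q1; first by rewrite (tail_snd Xq q1) ler_norml;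
  case: (ger0P (p.1 - q.1)) => ?; apply/andP; split; lra.
move: (square_snd Xq (ltW q1)); rewrite ler_norml => /andP[].
rewrite ler_norml; case: (ger0P q.1) => ? ? ?; case: (ger0P (p.1 - q.1)) => ?;
  apply/andP; split; lra.
Qed.

(** The triangle inequality through the cusp (-1, 0), from which every point of
    X is at distance |x + 1|. *)
Lemma dist_cusp p q : spaceX p -> spaceX q -> -1 <= p.1 -> -1 <= q.1 ->
  mdist p q <= (p.1 + 1) + (q.1 + 1).
Proof.
move=> Xp Xq p1 q1; rewrite dist_le.
move: (square_snd Xp p1) (square_snd Xq q1); rewrite !ler_norml.
by case: (ger0P p.1) => ?; case: (ger0P q.1) => ? /andP[? ?] /andP[? ?];
  apply/and4P; split; lra.
Qed.

Lemma square_segment p q t : spaceX p -> spaceX q -> -1 <= p.1 -> -1 <= q.1 ->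
  0 <= t <= 1 -> spaceX (segment p q t).
Proof.
move=> Xp Xq p1 q1 /andP[t0 t1]; apply: square_spaceX.
move: (square_snd Xp p1) (square_snd Xq q1) => /= hp hq.
apply: le_trans (ler_normD _ _) _.
rewrite !normrM (ger0_norm t0) ger0_norm; last lra.
have := ler_normD ((1 - t) * p.1) (t * q.1).
by rewrite !normrM (ger0_norm t0) ger0_norm; [nra|lra].
Qed.

(** * The two conical bicombings on X *)

Definition upper p q t : R * R := projX (segment p q t).

Lemma upper_fst p q t : (upper p q t).1 = (1 - t) * p.1 + t * q.1.
Proof. by []. Qed.

Lemma spaceX_trapezoid p : spaceX p -> trapezoid p.
Proof. by case/spaceXE. Qed.

Lemma upper_conical : conical (@spaceX R) upper.
Proof.
move=> p q p' q' t /spaceX_trapezoid Yp /spaceX_trapezoid Yq.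
move=> /spaceX_trapezoid Yp' /spaceX_trapezoid Yq' t01.
apply: le_trans (segment_dist _ _ _ _ t01).
by apply: projX_lipschitz; exact: trapezoid_segment.
Qed.

Lemma upper_bicombing : bicombing (@spaceX R) upper.
Proof.
split=> [p q t Xp Xq t01|p q Xp Xq].
  by apply/projX_trapezoid/trapezoid_segment => //; exact: spaceX_trapezoid.
have e0 : upper p q 0 = p by rewrite /upper segment0 projX_spaceX.
have e1 : upper p q 1 = q by rewrite /upper segment1 projX_spaceX.
split=> //; apply: lipschitz_geodesic => // s t s01 t01.
rewrite -segment_speed; apply: projX_lipschitz;
  by apply: trapezoid_segment => //; exact: spaceX_trapezoid.
Qed.

Lemma reflect_yK : involutive (@reflect_y R).
Proof. by case=> x y; rewrite /reflect_y /= opprK. Qed.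

Lemma projX_reflect p : projX (reflect_y p) = reflect_y (projX p).
Proof. by rewrite /projX /reflect_y /= normrN sgrN mulNr. Qed.

Lemma segment_reflect p q t :
  segment (reflect_y p) (reflect_y q) t = reflect_y (segment p q t).
Proof.
apply: injective_projections => //=.
by rewrite /GRing.scale /= !mulrN opprD.
Qed.

(** The symmetry of X obtained from the isometry f of X' onto X by identifying
    X' with X through the reflection; f is its own inverse as a map of the
    plane, so composing with the reflection on either side gives the same map
    ([isoX_reflect]). *)
Definition flip p := reflect_y (isoX p).

Lemma flip_fst p : (flip p).1 = p.1.
Proof. by rewrite /flip /isoX; case: ifP. Qed.

Lemma flip_tail p : p.1 < -1 -> flip p = p.
Proof.
by case: p => x y /= x1; rewrite /flip /isoX /= leNgt x1 /reflect_y /= opprK.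
Qed.

Lemma flip_square p : -1 <= p.1 -> flip p = reflect_y p.
Proof. by rewrite /flip /isoX => ->. Qed.

Lemma flipK : involutive flip.
Proof.
move=> [x y]; case: (lerP (-1) x) => x1; last by rewrite !flip_tail.
by rewrite !flip_square//= /reflect_y /= opprK.
Qed.

Lemma flip_spaceX p : spaceX p -> spaceX (flip p).
Proof.
case: (lerP (-1) p.1) => p1 Xp; last by rewrite flip_tail.
by rewrite flip_square//; apply: square_spaceX; rewrite /= normrN square_snd.
Qed.

Lemma flip_dist p q : spaceX p -> spaceX q ->
  mdist (flip p) (flip q) = mdist p q.
Proof.
move=> Xp Xq; have Xfp := flip_spaceX Xp; have Xfq := flip_spaceX Xq.
case: (lerP (-1) p.1) => p1; last first.
  by rewrite !dist_tail ?flip_fst// ltW.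
case: (lerP (-1) q.1) => q1; last first.
  by rewrite metric_sym (metric_sym p) !dist_tail ?flip_fst// ltW.
by rewrite !flip_square// !distE /= -opprD normrN.
Qed.

Definition lower := conjugate flip upper.

Lemma lower_bicombing : bicombing (@spaceX R) lower.
Proof.
exact: bicombing_conjugate flipK flip_spaceX flip_dist upper_bicombing.
Qed.

Lemma lower_conical : conical (@spaceX R) lower.
Proof.
exact: conical_conjugate flip_spaceX flip_dist upper_bicombing upper_conical.
Qed.

Lemma lower_fst p q t : (lower p q t).1 = (1 - t) * p.1 + t * q.1.
Proof. by rewrite flip_fst upper_fst !flip_fst. Qed.

(** The square is convex and truncation leaves it fixed, so both constructions
    give straight segments in it. *)
Lemma lower_square p q t : spaceX p -> spaceX q -> -1 <= p.1 -> -1 <= q.1 ->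
  0 <= t <= 1 -> lower p q t = upper p q t.
Proof.
move=> Xp Xq p1 q1 t01; have Xs := square_segment Xp Xq p1 q1 t01.
rewrite /lower /conjugate /upper (projX_spaceX Xs) projX_spaceX; last first.
  by apply: square_segment; rewrite ?flip_fst//; exact: flip_spaceX.
have s1 : -1 <= (segment p q t).1.
  by move/andP: t01 => [t0 t1] /=; rewrite /GRing.scale /=; nra.
by apply: (can_inj flipK); rewrite flipK !flip_square// segment_reflect.
Qed.

(** * Gluing rightward and leftward segments *)

(** Opposite directions matter only when both segments have an end in the tail:
    then the tail ends are p, where one segment starts, and q', where the other
    one stops, so each is compared with an end point of the other segment. *)
Lemma upper_lower_conical p q p' q' t :
  spaceX p -> spaceX q -> spaceX p' -> spaceX q' ->
  p.1 <= q.1 -> q'.1 <= p'.1 -> 0 <= t <= 1 ->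
  mdist (upper p q t) (lower p' q' t) <= (1 - t) * mdist p p' + t * mdist q q'.
Proof.
move=> Xp Xq Xp' Xq' pq qp' t01.
case: (lerP (-1) p.1) => p1.
  rewrite -lower_square//; first exact: lower_conical.
  exact: le_trans pq.
case: (lerP (-1) q'.1) => q1.
  rewrite lower_square//; first exact: upper_conical.
  exact: le_trans qp'.
have Xz : spaceX (upper p q t) by apply: (upper_bicombing).1.
have Xz' : spaceX (lower p' q' t) by apply: (lower_bicombing).1.
rewrite (dist_tail Xp Xp' (ltW p1)).
rewrite (metric_sym q) (dist_tail Xq' Xq (ltW q1)).
have [t0 t1] := andP t01.
(* The estimate along the x-axis, enough as soon as the distance on the left is
   a difference of abscissae. *)
have tail : mdist (upper p q t) (lower p' q' t) =
    `|(upper p q t).1 - (lower p' q' t).1| ->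
    mdist (upper p q t) (lower p' q' t) <=
    (1 - t) * `|p.1 - p'.1| + t * `|q'.1 - q.1|.
  move=> ->; rewrite upper_fst lower_fst (distrC q'.1).
  have -> : (1 - t) * p.1 + t * q.1 - ((1 - t) * p'.1 + t * q'.1) =
    (1 - t) * (p.1 - p'.1) + t * (q.1 - q'.1) by ring.
  apply: le_trans (ler_normD _ _) _.
  by rewrite !normrM (ger0_norm t0) ger0_norm// subr_ge0.
case: (lerP (-1) (upper p q t).1) => z1; last first.
  by apply: tail; rewrite dist_tail// ltW.
case: (lerP (-1) (lower p' q' t).1) => z1'; last first.
  by apply: tail; rewrite metric_sym distrC dist_tail// ltW.
apply: le_trans (dist_cusp Xz Xz' z1 z1') _.
(* Since p.1 and q'.1 are less than -1, replacing p.1 + 2 by - p.1 and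
   q'.1 + 2 by - q'.1 only increases the bound. *)
rewrite upper_fst lower_fst (distrC p.1) (distrC q'.1).
have := ler_norm (p'.1 - p.1); have := ler_norm (q.1 - q'.1); nra.
Qed.

Lemma sigma_rightward p q t : p.1 <= q.1 -> sigma p q t = upper p q t.
Proof. by rewrite /sigma => ->. Qed.

Lemma isoX_reflect p : isoX (reflect_y p) = flip p.
Proof. by rewrite /flip /isoX /=; case: ifP. Qed.

Lemma sigma_leftward p q t : spaceX p -> spaceX q -> q.1 <= p.1 ->
  sigma p q t = lower p q t.
Proof.
move=> Xp Xq qp; rewrite sigma_ge// !isoX_invE//.
rewrite -[isoX p]reflect_yK -[isoX q]reflect_yK segment_reflect projX_reflect.
exact: isoX_reflect.
Qed.

Lemma sigma_bicombing : bicombing (@spaceX R) (@sigma R).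
Proof.
split=> [p q t Xp Xq t01|p q Xp Xq].
  case: (lerP p.1 q.1) => [pq|/ltW qp].
    by rewrite sigma_rightward//; apply: (upper_bicombing).1.
  by rewrite sigma_leftward//; apply: (lower_bicombing).1.
case: (lerP p.1 q.1) => [pq|/ltW qp].
  have [e0 e1 ed] := (upper_bicombing).2 _ _ Xp Xq.
  by split=> [||s t s01 t01]; rewrite !sigma_rightward//; exact: ed.
have [e0 e1 ed] := (lower_bicombing).2 _ _ Xp Xq.
by split=> [||s t s01 t01]; rewrite !sigma_leftward//; exact: ed.
Qed.

Lemma sigma_conical : conical (@spaceX R) (@sigma R).
Proof.
move=> p q p' q' t Xp Xq Xp' Xq' t01.
case: (lerP p.1 q.1) => [pq|/ltW qp]; case: (lerP p'.1 q'.1) => [pq'|/ltW qp'].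
- by rewrite !sigma_rightward//; exact: upper_conical.
- by rewrite sigma_rightward// sigma_leftward//; exact: upper_lower_conical.
- rewrite sigma_leftward// sigma_rightward// metric_sym.
  by rewrite (metric_sym p) (metric_sym q); exact: upper_lower_conical.
- by rewrite !sigma_leftward//; exact: lower_conical.
Qed.

(** The points (-2, 1) and (1, 0) are fixed by [flip], so the leftward segment
    between them is the image of the rightward one under [flip], which moves
    the midpoint. *)
Lemma sigma_nonreversible : ~ reversible (@spaceX R) (@sigma R).
Proof.
pose p : R * R := (-2, 1); pose q : R * R := (1, 0).
pose m : R * R := (- 2^-1, 2^-1).
have Xp : spaceX p.
  apply/spaceXE; rewrite /trapezoid /=.
  by case: (ger0P (-2 + 1)) => ?; (split; [split|]); lra.
have Xq : spaceX q by apply: square_spaceX; rewrite /= normr0 normr1 subrr.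
have Xm : spaceX m by apply: square_spaceX; rewrite /= normrN !ger0_norm; lra.
have half : 1 - 2^-1 = 2^-1 :> R by lra.
have fp : flip p = p by rewrite flip_tail //=; lra.
have fq : flip q = q.
  by rewrite flip_square; [rewrite /reflect_y /= oppr0|rewrite /=; lra].
have fm : flip m = (- 2^-1, - 2^-1) by rewrite flip_square //=; lra.
have up : upper p q 2^-1 = m.
  rewrite /upper (_ : segment p q 2^-1 = m) ?projX_spaceX//.
  by apply: injective_projections; rewrite /= /GRing.scale /=; lra.
have lo : lower q p 2^-1 = flip m.
  rewrite -up /lower /conjugate fp fq /upper /segment half.
  by rewrite [in LHS]addrC.
move=> /(_ p q 2^-1 Xp Xq); rewrite half => rev.
have {rev} : sigma p q 2^-1 = sigma q p 2^-1 by apply: rev; lra.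
have pq : p.1 <= q.1 by rewrite /=; lra.
rewrite (sigma_rightward _ pq) (sigma_leftward _ Xq Xp pq).
by rewrite up lo fm => -[]; lra.
Qed.

End MaxNorm.

Theorem lemma3p1 (R : realType) :
  [/\ bicombing (@spaceX R) (@sigma R),
      conical (@spaceX R) (@sigma R)
    & ~ reversible (@spaceX R) (@sigma R)].
Proof.
split.
- exact: sigma_bicombing.
- exact: sigma_conical.
- exact: sigma_nonreversible.
Qed.
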